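(* Let $k\ge 2$, $n\ge1$, and let $0<\epsilon<0.0001$ be a constant. Let $C$ be any deterministic $k$-party protocol with error $\epsilon$ under $\mathcal{P}$, i.e. $\Pr_{x\sim \mathcal{P}}[C(x) = k\text{-}\mathrm{UDISJ}(x)] \geq 1-\epsilon$. Then \[ \mathcal{I}(\mathcal{Q},\mathcal{W}:\mathcal{R}_{C}) = \Omega(n/k), \] where the implied constant does not depend on $n$, $k$ or $C$.
   Context: $k\text{-}\mathrm{UDISJ}(x)=0$ for $x\in D_0:=\{(x_1,\dots,x_k)\in(\{0,1\}^n)^k: \forall i,\ \sum_j x_j(i)\le1\}$ and $=1$ for $x\in D_*:=\{x: \exists\ell,\ x_1(\ell)=\cdots=x_k(\ell)=1,\ \forall i\ne\ell,\ \sum_j x_j(i)\le 1\}$. The distribution $\mathcal{P}$ on $(\{0,1\}^n)^k$: for every $i\in[n]$ independently sample $\mathcal{W}_i$ uniform in $[k]$ and $\mathcal{A}_i$ uniform in $\{0,1\}$; set $x_j(i)=1$ iff $\mathcal{W}_i=j$ and $\mathcal{A}_i=1$; then sample $\mathcal{B}$ uniform in $\{0,1\}$ and $\ell$ uniform in $[n]$, and if $\mathcal{B}=1$ set $x_j(\ell)=1$ for all $j$; output $x=(x_1,\dots,x_k)$. Let $\mathcal{Q}$ be $\mathcal{P}$ conditioned on $\mathcal{B}=0$, and $\mathcal{W}=(\mathcal{W}_1,\dots,\mathcal{W}_n)$ (jointly distributed with $x\sim\mathcal{Q}$). A deterministic protocol partitions the inputs into leaf rectangles; $\mathcal{R}_C$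 is the random leaf rectangle of $C$ containing $x$, where $x\sim\mathcal{Q}$. $\mathcal{I}(\cdot:\cdot)$ is (Shannon) mutual information between the pair $(x,\mathcal{W})$ and $\mathcal{R}_C$. *)

(* Defs.v *)
From mathcomp Require Import all_boot all_order all_algebra.
From mathcomp Require Import reals exp.

Set Implicit Arguments.
Unset Strict Implicit.
Unset Printing Implicit Defensive.

Import Order.TTheory GRing.Theory Num.Theory.
Local Open Scope ring_scope.

Section FiniteProbability.
Variables (R : realType) (T : finType).

Definition uniform : T -> R := fun=> #|T|%:R^-1.

Definition prob (p : T -> R) (E : pred T) : R := \sum_(t | E t) p t.

Definition cond (p : T -> R) (E : pred T) : T -> R :=
  fun t => if E t then p t / prob p E else 0.

Definition law (p : T -> R) (U : finType) (X : T -> U) : U -> R :=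
  fun u => prob p (fun t => X t == u).

Definition log2 (x : R) : R := ln x / ln 2.

(* Shannon mutual information, in bits.  The convention 0 log 0 = 0 holds
   because the factor in front of the logarithm vanishes. *)
Definition mutual_info (p : T -> R) (U V : finType) (X : T -> U) (Y : T -> V) :
    R :=
  \sum_u \sum_v
    law p (fun t => (X t, Y t)) (u, v) *
    log2 (law p (fun t => (X t, Y t)) (u, v) / (law p X u * law p Y v)).

End FiniteProbability.

Arguments uniform : clear implicits.

Notation bits n := {ffun 'I_n -> bool}.

(* x j i is the bit x_j(i). *)
Notation input k n := {ffun 'I_k -> bits n}.

Section UniqueDisjointness.
Variables k n : nat.

Definition D0 : {set input k n} :=
  [set x : input k n | [forall i, \sum_j (x j i : nat) <= 1]%N].

Definition Dstar : {set input k n} :=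
  [set x : input k n | [exists l, [forall j, x j l] &&
    [forall (i | i != l), \sum_j (x j i : nat) <= 1]]%N].

(* None outside the promise; D0 and Dstar are disjoint when 2 <= k. *)
Definition kUDISJ (x : input k n) : option bool :=
  if x \in D0 then Some false
  else if x \in Dstar then Some true
  else None.

End UniqueDisjointness.

(* Number-in-hand protocols: at Node j f C0 C1 party j announces the bit
   f x_j, which depends on that party's input only, and the parties continue
   with C0 or C1 accordingly. *)
Inductive protocol (k n : nat) : Type :=
| Leaf of bool
| Node (j : 'I_k) (f : bits n -> bool) (C0 C1 : protocol k n).

Section Protocols.
Variables k n : nat.

Fixpoint output (C : protocol k n) (x : input k n) : bool :=
  match C with
  | Leaf b => b
  | Node j f C0 C1 => if f (x j) then output C1 x else output C0 x
  end.

(* The path from the root to the leaf reached by x; it identifies the leaf. *)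
Fixpoint leaf (C : protocol k n) (x : input k n) : seq bool :=
  match C with
  | Leaf _ => [::]
  | Node j f C0 C1 =>
      if f (x j) then true :: leaf C1 x else false :: leaf C0 x
  end.

Definition leaf_rect (C : protocol k n) (x : input k n) : {set input k n} :=
  [set y | leaf C y == leaf C x].

End Protocols.

(* (W, A, B, l).  All of these are independent and uniform, so their joint
   law is uniform on the product. *)
Notation outcome k n := ({ffun 'I_n -> 'I_k} * bits n * bool * 'I_n)%type.

Section HardDistribution.
Variables (R : realType) (k n : nat).

Definition rvW (t : outcome k n) : {ffun 'I_n -> 'I_k} := t.1.1.1.
Definition rvA (t : outcome k n) : bits n := t.1.1.2.
Definition rvB (t : outcome k n) : bool := t.1.2.
Definition rvl (t : outcome k n) : 'I_n := t.2.

Definition rvx (t : outcome k n) : input k n :=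
  [ffun j => [ffun i =>
    (rvB t && (i == rvl t)) || ((rvW t i == j) && rvA t i)]].

Definition distP : input k n -> R := law (uniform R (outcome k n)) rvx.

(* The joint law of (W, A, B, l) given B = 0; the law of x under it is Q. *)
Definition jointQ : outcome k n -> R :=
  cond (uniform R (outcome k n)) (fun t => ~~ rvB t).

End HardDistribution.

Arguments distP : clear implicits.
Arguments jointQ : clear implicits.

(* Main.v *)
Require Import Defs.
From mathcomp Require Import all_boot all_order all_algebra.
From mathcomp Require Import reals exp.
From mathcomp Require Import ring lra.

(**
Given [W], the coordinates of [x] are independent, so the information revealed
by the leaf is at least the sum over the coordinates [i] of the information
about [A_i].  Let [p_S] be the law of the leaf when the column [i] is replaced
by the indicator of [S] (for fixed values of [W] outside [i]).  The information
about [A_i] is at least, up to a constant, the squared Hellinger distance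
between [p_0] and [p_{j}], averaged over [j = W_i].  Since leaves are
rectangles, [p_0 p_(S u S') = p_S p_S'] pointwise for disjoint [S], [S'];
with the inequality [sum_(a, b) |v_a - v_b|^2 <= 2 t sum_a |v_a|^2] for [t]
vectors this shows that merging a random pair of blocks in a partition into [t]
blocks increases the sum of the squared distances to [p_0] by a factor of at
most [1 + 2/(t(t-1))].  The product of these factors converges, so the
distance from [p_0] to [p_[k]] is at most 6 times the sum of the distances to
the [p_{j}].  Correctness of the protocol forces the former to be of constant
size on average.
*)

Set Implicit Arguments.
Unset Strict Implicit.
Unset Printing Implicit Defensive.

Import Order.TTheory GRing.Theory Num.Theory.
Local Open Scope ring_scope.

Lemma sum_const_natl (R : pzRingType) (I : finType) (A : {pred I}) (c : R) :
  \sum_(i in A) c = #|A|%:R * c.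
Proof. by rewrite sumr_const mulr_natl. Qed.

(** * Merging the blocks of a partition two at a time *)

Section Merging.
Variables (R : realFieldType) (T : finType) (H : {set T} -> R).

(* Indexed by the number of blocks minus one. *)
Fixpoint merge_const (m : nat) : R :=
  if m is m'.+1 then merge_const m' * (1 + 2 / (m'.+1%:R * m'.+2%:R)) else 1.

Lemma merge_const_ge0 m : 0 <= merge_const m.
Proof.
by elim: m => //= m IH; rewrite mulr_ge0 // addr_ge0 // divr_ge0 // mulr_ge0.
Qed.

(** The bound 6 alone is not inductive, as every factor exceeds 1. The induction carries a sequence
    that increases to 6 and is attained at [m = 0]. *)
Lemma merge_const_le m : merge_const m.+1 <= 6 * (m.+1%:R / m.+3%:R).
Proof.
elim: m => [|m IH]; first by rewrite /=; lra.
rewrite [merge_const _]/=; set c := merge_const _ in IH *.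
apply: le_trans (ler_wpM2r _ IH) _; first by rewrite addr_ge0 ?divr_ge0 ?mulr_ge0.
have y0 : 0 < m.+1%:R :> R by rewrite ltr0Sn.
have -> : m.+2%:R = m.+1%:R + 1 :> R by rewrite natr1.
have -> : m.+3%:R = m.+1%:R + 2 :> R by rewrite -natrD addn2.
have -> : m.+4%:R = m.+1%:R + 3 :> R by rewrite -natrD addn3.
move: (m.+1%:R) y0 => y y0; rewrite -subr_ge0.
have -> : 6 * ((y + 1) / (y + 3)) - 6 * (y / (y + 2)) * (1 + 2 / ((y + 1) * (y + 2)))
    = 24 / ((y + 1) * (y + 2) ^+ 2 * (y + 3)).
  by field; rewrite !gt_eqF // addr_gt0.
by rewrite divr_ge0 // !mulr_ge0 // addr_ge0 // ltW.
Qed.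

Hypothesis H_merge : forall P : {set {set T}}, trivIset P -> set0 \notin P ->
  \sum_(a in P) \sum_(b in P :\ a) H (a :|: b) <= 2 * #|P|%:R * \sum_(a in P) H a.

Lemma merge_step (P : {set {set T}}) a b :
    trivIset P -> set0 \notin P -> a \in P -> b \in P :\ a ->
  let P' := (a :|: b) |: (P :\ a :\ b) in
  [/\ trivIset P', set0 \notin P', #|P| = #|P'|.+1, cover P' = cover P
    & \sum_(c in P') H c = \sum_(c in P) H c - H a - H b + H (a :|: b)].
Proof.
move=> tP P0 aP bP P'; have bP' : b \in P by case/setD1P: bP.
have a0 : a != set0 by apply: contraNneq P0 => <-.
have sub : P :\ a :\ b \subset P by rewrite !subDset !subsetU ?subxx ?orbT.
have dis : {in P :\ a :\ b, forall c : {set T}, [disjoint a :|: b & c]}.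
  move=> c /setD1P [cb /setD1P [ca cP]].
  rewrite -setI_eq0 setIUl setU_eq0 !setI_eq0.
  have D := trivIsetP tP.
  by rewrite !D // eq_sym.
have [tP' nP'] := trivIsetU1 dis (trivIsetS sub tP) (contra (subsetP sub _) P0).
split=> //.
- rewrite in_setU1 negb_or eq_sym setU_eq0 negb_and a0 /=.
  by apply: contra P0; apply: subsetP.
- by rewrite /P' cardsU1 nP' (cardsD1 a P) aP (cardsD1 b (P :\ a)) bP.
- rewrite /P' /cover big_setU1 //= [RHS](big_setD1 a) //=.
  by rewrite [X in _ = _ :|: X](big_setD1 b) //= setUA.
- rewrite /P' big_setU1 //= [X in _ = X - _ - _ + _](big_setD1 a) //=.
  by rewrite [X in _ = _ + X - _ - _ + _](big_setD1 b) //=; ring.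
Qed.

(** In the induction step all ordered pairs among the [t] blocks are merged and the resulting bounds
    are summed. By [H_merge] the new block sums add up to at most
    [t(t-1) - 2(t-1) + 2t = t(t-1) + 2] times the old one; dividing by the [t(t-1)] pairs gives the
    new factor. *)
Lemma merge_le (m : nat) (P : {set {set T}}) :
    trivIset P -> set0 \notin P -> #|P| = m.+1 ->
  H (cover P) <= merge_const m * \sum_(a in P) H a.
Proof.
elim: m P => [|m IH] P tP P0 cP.
  have /cards1P [a ->] : #|P| == 1 by rewrite cP.
  by rewrite /cover !big_set1 mul1r.
set Phi := \sum_(a in P) H a.
have Dcard a : a \in P -> #|P :\ a| = m.+1.
  by move=> aP; move: cP; rewrite (cardsD1 a) aP => -[].
have Dsum a : a \in P -> \sum_(b in P :\ a) H b = Phi - H a.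
  by move=> aP; rewrite /Phi [X in _ = X - _](big_setD1 a) //=; ring.
have step a b : a \in P -> b \in P :\ a ->
    H (cover P) <= merge_const m * (Phi - H a - H b + H (a :|: b)).
  move=> aP bP; have [tP' P0' cP' <- <-] := merge_step tP P0 aP bP.
  by apply: IH => //; move: cP'; rewrite cP => -[].
have : \sum_(a in P) \sum_(b in P :\ a) H (cover P) <=
    \sum_(a in P) \sum_(b in P :\ a)
      merge_const m * (Phi - H a - H b + H (a :|: b)).
  by apply: ler_sum => a aP; apply: ler_sum => b bP; apply: step.
rewrite (eq_bigr (fun=> m.+1%:R * H (cover P))); last first.
  by move=> a aP; rewrite sum_const_natl Dcard.
rewrite sum_const_natl cP mulrA.
under eq_bigr do rewrite -mulr_sumr.
(* For fixed [a] the terms [H b] add up to [Phi - H a], which cancels one of its [m.+1] copies. *)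
rewrite -mulr_sumr (eq_bigr (fun a => m%:R * (Phi - H a) +
    \sum_(b in P :\ a) H (a :|: b))); last first.
  move=> a aP; rewrite big_split /= sumrB Dsum // sum_const_natl Dcard //.
  by rewrite -natr1; ring.
rewrite big_split /= -mulr_sumr sumrB sum_const_natl cP -/Phi.
move=> le1; rewrite -(@ler_pM2l _ (m.+2%:R * m.+1%:R)) ?mulr_gt0 ?ltr0Sn //.
apply: le_trans le1 _.
have := H_merge tP P0; rewrite cP -/Phi => le2.
apply: (le_trans (ler_wpM2l (merge_const_ge0 m) (lerD (lexx _) le2))).
have y0 : 0 <= m%:R :> R by [].
have -> : m.+1%:R = m%:R + 1 :> R by rewrite natr1.
have -> : m.+2%:R = m%:R + 2 :> R by rewrite -natrD addn2.
rewrite le_eqVlt; apply/orP; left; apply/eqP.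
by field; rewrite !gt_eqF // ltr_wpDl.
Qed.

Lemma merge_singletons :
  (forall S, 0 <= H S) -> (2 <= #|T|)%N -> H setT <= 6 * \sum_j H [set j].
Proof.
move=> H0 cT; pose P : {set {set T}} := [set [set x] | x in [set: T]].
have inj : injective (fun x : T => [set x]) by exact: set1_inj.
have cP : #|P| = #|T| by rewrite card_imset // cardsT.
have tP : trivIset P.
  apply/trivIsetP => _ _ /imsetP [x _ ->] /imsetP [y _ ->] xy.
  by rewrite disjoints1 in_set1; apply: contra xy => /eqP ->.
have P0 : set0 \notin P.
  by apply/imsetP => -[x _] /setP /(_ x); rewrite in_set0 set11.
have eP : cover P = setT.
  apply/setP => x; rewrite in_setT; apply/bigcupP; exists [set x]; last exact: set11.
  by apply/imsetP; exists x.
(* [merge_const_le] starts at one merge, that is, at two blocks. *)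
have [m cm] : exists m, #|P| = m.+2.
  by rewrite cP; case: #|T| cT => [|[|m]] // _; exists m.
have sP : \sum_(a in P) H a = \sum_j H [set j].
  rewrite /P big_imset /=; last by move=> x y _ _; apply: inj.
  by apply: eq_bigl => x; rewrite in_setT.
have := merge_le tP P0 cm; rewrite eP sP => le1.
apply: le_trans le1 _; apply: ler_wpM2r; first exact: sumr_ge0.
apply: le_trans (merge_const_le m) _.
rewrite -[leRHS]mulr1 ler_wpM2l // ler_pdivrMr ?ltr0Sn // mul1r ler_nat.
by rewrite ltnW.
Qed.

End Merging.

(** * Hellinger distances in a family with the cut property *)

Section Hellinger.
Variables (R : realFieldType) (V T : finType) (f : {set T} -> V -> R).

(** When [f S] is the square root of a probability law, this is one minus the Bhattacharyya
    coefficient: the squared Hellinger distance from the law of [set0]. *)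
Definition hellinger (S : {set T}) : R := 1 - \sum_v f set0 v * f S v.

Hypothesis f_unit : forall S, \sum_v f S v ^+ 2 = 1.
Hypothesis f_cut : forall S S' : {set T}, [disjoint S & S'] ->
  forall v, f set0 v * f (S :|: S') v = f S v * f S' v.

Lemma sum_sqrB S S' :
  \sum_v (f S v - f S' v) ^+ 2 = 2 * (1 - \sum_v f S v * f S' v).
Proof.
rewrite (eq_bigr (fun v => f S v ^+ 2 + f S' v ^+ 2 - 2 * (f S v * f S' v))).
  by rewrite sumrB big_split /= !f_unit -mulr_sumr; ring.
by move=> v _; ring.
Qed.

Lemma hellinger_ge0 S : 0 <= hellinger S.
Proof.
rewrite -(@pmulr_rge0 _ 2) // -sum_sqrB.
by apply: sumr_ge0 => v _; apply: sqr_ge0.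
Qed.

(** With [u = g - c] the left side equals [2 |P| sum u^2 - 2 (sum u)^2]; the last square is
    dropped. *)
Lemma sum_pair_sqrB_le (I : finType) (P : {set I}) (g : I -> R) (c : R) :
  \sum_(a in P) \sum_(b in P) (g a - g b) ^+ 2 <=
  2 * #|P|%:R * \sum_(a in P) (c - g a) ^+ 2.
Proof.
set u := fun a => g a - c; set s1 := \sum_(a in P) u a.
set s2 := \sum_(a in P) u a ^+ 2.
have -> : \sum_(a in P) (c - g a) ^+ 2 = s2.
  by apply: eq_bigr => a _; rewrite /u; ring.
suff -> : \sum_(a in P) \sum_(b in P) (g a - g b) ^+ 2 =
    2 * #|P|%:R * s2 - 2 * s1 ^+ 2.
  by rewrite gerBl mulr_ge0 ?sqr_ge0.
rewrite (eq_bigr (fun a => #|P|%:R * u a ^+ 2 + s2 - 2 * s1 * u a)); last first.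
  move=> a _; rewrite (eq_bigr (fun b => u a ^+ 2 + u b ^+ 2 - 2 * u a * u b)).
    by rewrite sumrB big_split /= sum_const_natl -mulr_sumr -/s1 -/s2; ring.
  by move=> b _; rewrite /u; ring.
rewrite sumrB big_split /= sum_const_natl -!mulr_sumr -/s1 -/s2; ring.
Qed.

(** The cut property turns the distance from [set0] to [a :|: b] into the one between [a] and [b].
    For each [v] this leaves pairwise squared differences, to be centred at [f set0 v]. *)
Lemma hellinger_merge (P : {set {set T}}) : trivIset P -> set0 \notin P ->
  \sum_(a in P) \sum_(b in P :\ a) hellinger (a :|: b) <=
  2 * #|P|%:R * \sum_(a in P) hellinger a.
Proof.
move=> /trivIsetP tP P0; rewrite -(@ler_pM2l _ 2) //.
have -> : 2 * (\sum_(a in P) \sum_(b in P :\ a) hellinger (a :|: b)) =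
    \sum_v \sum_(a in P) \sum_(b in P) (f a v - f b v) ^+ 2.
  rewrite mulr_sumr [RHS]exchange_big /=; apply: eq_bigr => a aP.
  rewrite [RHS]exchange_big /= [RHS](big_setD1 a) //=.
  rewrite [X in _ = X + _]big1; last by move=> v _; rewrite subrr expr0n.
  rewrite add0r mulr_sumr; apply: eq_bigr => b /setD1P [ba bP].
  rewrite sum_sqrB /hellinger; congr (2 * (1 - _)); apply: eq_bigr => v _.
  by apply: f_cut; apply: tP; rewrite // eq_sym.
have -> : 2 * (2 * #|P|%:R * \sum_(a in P) hellinger a) =
    \sum_v 2 * #|P|%:R * \sum_(a in P) (f set0 v - f a v) ^+ 2.
  rewrite -mulr_sumr exchange_big /= mulrCA; congr (_ * _).
  by rewrite mulr_sumr; apply: eq_bigr => a _; rewrite sum_sqrB.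
by apply: ler_sum => v _; apply: sum_pair_sqrB_le.
Qed.

Lemma hellinger_full_le : (2 <= #|T|)%N ->
  hellinger setT <= 6 * \sum_j hellinger [set j].
Proof.
by apply: merge_singletons => //; [exact: hellinger_merge|exact: hellinger_ge0].
Qed.

End Hellinger.

(** * Gibbs' inequality and the information about single bits *)

Section Gibbs.
Variable R : realType.

Lemma ln_leB1 (y : R) : 0 < y -> ln y <= y - 1.
Proof.
by move=> y0; have := @le_ln1Dx R (y - 1); rewrite subrKC; apply; lra.
Qed.

Lemma ln_prod (I : Type) (r : seq I) (g : I -> R) :
  (forall i, 0 < g i) -> ln (\prod_(i <- r) g i) = \sum_(i <- r) ln (g i).
Proof.
move=> g0; elim: r => [|i r IH]; first by rewrite !big_nil ln1.
by rewrite !big_cons lnM ?IH // posrE // prodr_gt0.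
Qed.

(** With [m = sqrt (s / 2)] and [r = sqrt a] the right side is [- 2 a ln (m / r)]. Applying
    [ln y <= y - 1] to this square root of the ratio produces the Hellinger-type term [m r]. *)
Lemma mul_ln_ratio_ge (a s : R) : 0 <= a -> 0 < s ->
  2 * a - 2 * Num.sqrt (s / 2) * Num.sqrt a <= a * ln (2 * a / s).
Proof.
move=> a0 s0; have [->|an0] := eqVneq a 0.
  by rewrite sqrtr0 !mulr0 !mul0r subr0.
have a_gt0 : 0 < a by rewrite lt_def an0.
set m := Num.sqrt (s / 2); set r := Num.sqrt a.
have m0 : 0 < m by rewrite sqrtr_gt0 divr_gt0.
have r0 : 0 < r by rewrite sqrtr_gt0.
have em : m ^+ 2 = s / 2 by rewrite sqr_sqrtr // divr_ge0 // ltW.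
have er : r ^+ 2 = a by rewrite sqr_sqrtr // ltW.
have -> : 2 * a / s = (m / r) ^- 2.
  rewrite expr_div_n em er invf_div.
  by field; rewrite gt_eqF.
rewrite lnV ?posrE ?exprn_gt0 ?divr_gt0 // lnXn ?divr_gt0 //.
have := ln_leB1 (divr_gt0 m0 r0) => le1.
have -> : 2 * a - 2 * m * r = a * (- ((m / r - 1) *+ 2)).
  by rewrite -er; field; rewrite gt_eqF.
by rewrite ler_wpM2l ?(ltW a_gt0) // lerN2 lerMn2r.
Qed.

(* With [m = sqrt ((a + b) / 2)], bounding each logarithm by [mul_ln_ratio_ge]
   leaves the slack [(2 m - sqrt a - sqrt b)^2 / 2]. *)
Lemma jensen_shannon_ge (a b : R) : 0 <= a -> 0 <= b ->
  (Num.sqrt a - Num.sqrt b) ^+ 2 / 2 <=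
  a * ln (2 * a / (a + b)) + b * ln (2 * b / (a + b)).
Proof.
move=> a0 b0; have [s0|s_gt0] := leP (a + b) 0.
  have -> : a = 0 by lra.
  have -> : b = 0 by lra.
  by rewrite sqrtr0 subrr expr0n /= !mul0r addr0.
apply: le_trans (lerD (mul_ln_ratio_ge a0 s_gt0) (mul_ln_ratio_ge b0 s_gt0)).
set m := Num.sqrt ((a + b) / 2).
have em : m ^+ 2 = (a + b) / 2 by rewrite sqr_sqrtr //; lra.
rewrite -[in 2 * a](sqr_sqrtr a0) -[in 2 * b](sqr_sqrtr b0).
have em' : 2 * m ^+ 2 = Num.sqrt a ^+ 2 + Num.sqrt b ^+ 2.
  by rewrite em !sqr_sqrtr //; field.
move: (Num.sqrt a) (Num.sqrt b) em' => r t em'.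
rewrite -subr_ge0.
have -> : 2 * r ^+ 2 - 2 * m * r + (2 * t ^+ 2 - 2 * m * t) - (r - t) ^+ 2 / 2 =
  (2 * m - r - t) ^+ 2 / 2.
  have -> : (2 * m - r - t) ^+ 2 / 2 =
    2 * m ^+ 2 - 2 * m * (r + t) + (r + t) ^+ 2 / 2 by field.
  by rewrite em'; field.
by rewrite divr_ge0 // sqr_ge0.
Qed.

Variables (n : nat) (V : finType) (Y : bits n -> V) (P : V -> R).

(** The joint law of [Y A] and the bit [A i] for uniform [A], kept as a count. *)
Definition fiber (v : V) (i : 'I_n) (b : bool) : nat :=
  #|[set A : bits n | (Y A == v) && (A i == b)]|.

Hypothesis P_ge0 : forall v, 0 <= P v.
Hypothesis P_sum : \sum_v P v <= 1.
Hypothesis P_gt0 : forall A, 0 < P (Y A).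

(* Gibbs' inequality against the density [P (Y A) * prod_i 2 bt_i(A_i)], where
   [bt_i] is the law of the i-th bit given [Y]: it yields at once that the
   (cross) entropy of [Y] dominates the sum of the informations of the bits. *)
Lemma cross_entropy_ge :
  \sum_i \sum_v
    (Num.sqrt (fiber v i true)%:R - Num.sqrt (fiber v i false)%:R) ^+ 2 / 2 <=
  \sum_A - ln (P (Y A)).
Proof.
pose N v i b : R := (fiber v i b)%:R.
pose bt v i b := N v i b / (N v i true + N v i false).
have N0 v i b : 0 <= N v i b by rewrite /N.
have NY A i : 0 < N (Y A) i (A i).
  by rewrite ltr0n card_gt0; apply/set0Pn; exists A; rewrite inE !eqxx.
have NS A i : 0 < N (Y A) i true + N (Y A) i false.
  have := NY A i; case: (A i) => lt0.
    by apply: ltr_wpDr.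
  by apply: ltr_wpDl.
have bt0 A i : 0 < bt (Y A) i (A i) by apply: divr_gt0.
pose y A := P (Y A) * \prod_i (2 * bt (Y A) i (A i)).
have y0 A : 0 < y A by rewrite mulr_gt0 // prodr_gt0 // => i _; rewrite mulr_gt0.
have ly A : ln (y A) = ln (P (Y A)) + \sum_i ln (2 * bt (Y A) i (A i)).
  rewrite lnM ?posrE // ?ln_prod // => [i|]; first by rewrite mulr_gt0.
  by rewrite prodr_gt0 // => i _; rewrite mulr_gt0.
have sumy : \sum_A y A <= \sum_(A : bits n) 1.
  rewrite (partition_big Y xpredT) //=.
  have -> : \sum_(A : bits n) 1 = (2 : R) ^+ n.
    by rewrite sumr_const card_ffun card_bool card_ord natrX.
  have le1 v : \sum_(A | Y A == v) y A <= 2 ^+ n * P v.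
    rewrite (eq_bigr (fun A : bits n => 2 ^+ n * P v * \prod_i bt v i (A i))); last first.
      move=> A /eqP YA; rewrite /y YA big_split /= prodr_const card_ord; ring.
    rewrite -mulr_sumr -[leRHS]mulr1.
    apply: ler_wpM2l; first by rewrite mulr_ge0 // exprn_ge0.
    have bt_ge0 i b : 0 <= bt v i b by rewrite divr_ge0 // addr_ge0.
    (* Enlarging the sum from the fibre of [v] to all [A] lets the sum of products factor over the
       coordinates. *)
    apply: (@le_trans _ _ (\sum_(A : bits n) \prod_i bt v i (A i))).
      rewrite [leRHS](bigID (fun A => Y A == v)) /= lerDl.
      by apply: sumr_ge0 => A _; apply: prodr_ge0.
    rewrite -(bigA_distr_bigA (fun i b => bt v i b)).
    apply: prodr_ile1 => i _; rewrite sumr_ge0 //= big_bool /= -mulrDl.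
    (* On an empty fibre the weights [bt] are 0, as division by zero gives 0, and they sum to 0
       instead of 1. *)
    have [->|nz] := eqVneq (N v i true + N v i false) 0; first by rewrite mul0r.
    by rewrite divff.
  apply: le_trans (ler_sum _ (fun v _ => le1 v)) _.
  by rewrite -mulr_sumr -[leRHS]mulr1 ler_wpM2l // exprn_ge0.
have : \sum_A ln (y A) <= 0.
  apply: le_trans (ler_sum _ (fun A _ => ln_leB1 (y0 A))) _.
  by rewrite sumrB subr_le0.
under eq_bigr do rewrite ly.
rewrite big_split /= exchange_big /= sumrN => le0.
suff le1 : \sum_i \sum_v (Num.sqrt (fiber v i true)%:R -
      Num.sqrt (fiber v i false)%:R) ^+ 2 / 2 <=
    \sum_i \sum_(A : bits n) ln (2 * bt (Y A) i (A i)) by lra.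
apply: ler_sum => i _.
(* Grouping by [Y A] and then by [A i] makes the logarithm constant on each class; the two classes
   of a value [v] form a Jensen-Shannon term. *)
rewrite [leRHS](partition_big Y xpredT) //=; apply: ler_sum => v _.
rewrite (partition_big (fun A : bits n => A i) xpredT) //= big_bool /=.
have sub b : \sum_(A : bits n | (Y A == v) && (A i == b)) ln (2 * bt (Y A) i (A i)) =
    N v i b * ln (2 * N v i b / (N v i true + N v i false)).
  rewrite (eq_bigr (fun=> ln (2 * bt v i b))); last by move=> A /andP [/eqP -> /eqP ->].
  rewrite sum_const_natl /bt mulrA /N /fiber.
  by congr (_%:R * _); apply: eq_card => A; rewrite inE.
by rewrite !sub; apply: jensen_shannon_ge.
Qed.

End Gibbs.

(** * Leaves are rectangles *)

Section Leaves.
Variables k n : nat.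

(** At each node of the common path the speaker holds its part of [x] or of [y], and both make it
    announce the same bit. *)
Lemma leaf_mix (C : protocol k n) (x y z : input k n) :
  leaf C x = leaf C y -> (forall j, z j = x j \/ z j = y j) ->
  leaf C z = leaf C x.
Proof.
elim: C => //= j f C0 IH0 C1 IH1 + zP.
case: ifP => fx; case: ifP => fy // [e]; case: (zP j) => ->; rewrite ?fx ?fy;
  by congr (_ :: _); auto.
Qed.

Lemma leaf_output (C : protocol k n) (x y : input k n) :
  leaf C x = leaf C y -> output C x = output C y.
Proof.
elim: C => //= j f C0 IH0 C1 IH1.
by case: ifP => fx; case: ifP => fy // [e]; auto.
Qed.

Lemma leaf_rect_eq (C : protocol k n) (x y : input k n) :
  leaf_rect C x = leaf_rect C y -> leaf C x = leaf C y.
Proof. by move/setP/(_ x); rewrite !inE eqxx => /esym/eqP. Qed.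

Lemma leaf_rect_mix (C : protocol k n) (x y z : input k n) :
  leaf_rect C x = leaf_rect C y -> (forall j, z j = x j \/ z j = y j) ->
  leaf_rect C z = leaf_rect C x.
Proof.
move=> /leaf_rect_eq e zP; apply/setP => t; rewrite !inE.
by rewrite (leaf_mix e zP).
Qed.

End Leaves.

(** * Replacing one column of the input *)

Section Coordinate.
Variables k n : nat.

Definition xin (w : {ffun 'I_n -> 'I_k}) (A : bits n) : input k n :=
  [ffun j => [ffun i => (w i == j) && A i]].

(** Column [i] ignores [w i] and [A i]. With [S = setT] this is the input sampled when [B = 1] and
    [l = i]. *)
Definition xset (i : 'I_n) (S : {set 'I_k}) (w : {ffun 'I_n -> 'I_k})
    (A : bits n) : input k n :=
  [ffun j => [ffun i' => if i' == i then j \in S else (w i' == j) && A i']].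

Lemma xset1E i (w : {ffun 'I_n -> 'I_k}) (A : bits n) :
  A i -> xset i [set w i] w A = xin w A.
Proof.
move=> Ai; apply/ffunP => j; apply/ffunP => i'; rewrite !ffunE.
by case: eqP => // ->; rewrite Ai andbT in_set1 eq_sym.
Qed.

Lemma xset0E i (w : {ffun 'I_n -> 'I_k}) (A : bits n) :
  ~~ A i -> xset i set0 w A = xin w A.
Proof.
move=> /negbTE Ai; apply/ffunP => j; apply/ffunP => i'; rewrite !ffunE.
by case: eqP => // ->; rewrite Ai andbF in_set0.
Qed.

Definition upd (T : Type) (g : {ffun 'I_n -> T}) (i : 'I_n) (c : T) :
    {ffun 'I_n -> T} :=
  [ffun i' => if i' == i then c else g i'].

Lemma updK (T : Type) (g : {ffun 'I_n -> T}) i c : upd (upd g i c) i (g i) = g.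
Proof. by apply/ffunP => i'; rewrite !ffunE; case: eqP => // ->. Qed.

Lemma upd_at (T : Type) (g : {ffun 'I_n -> T}) i c : upd g i c i = c.
Proof. by rewrite ffunE eqxx. Qed.

Lemma xset_updA i S w A b : xset i S w (upd A i b) = xset i S w A.
Proof.
by apply/ffunP => j; apply/ffunP => i'; rewrite !ffunE; case: eqP.
Qed.

Lemma xset_updw i S w A j : xset i S (upd w i j) A = xset i S w A.
Proof.
by apply/ffunP => j'; apply/ffunP => i'; rewrite !ffunE; case: eqP.
Qed.

(** The map from [(w, j)] to [(upd w i j, w i)] is an involution. The identity serves to resample
    [W_i]. *)
Lemma sum_upd (R : comPzRingType) (i : 'I_n) (F : {ffun 'I_n -> 'I_k} -> R) :
  \sum_w \sum_j F (upd w i j) = k%:R * \sum_w F w.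
Proof.
pose h (p : {ffun 'I_n -> 'I_k} * 'I_k) := (upd p.1 i p.2, p.1 i).
have hK : involutive h by case=> w j; rewrite /h /= upd_at updK.
rewrite pair_big /= (reindex_inj (inv_inj hK)) /=.
under eq_bigr => p _ do rewrite updK.
rewrite -(pair_big xpredT xpredT (fun w (j : 'I_k) => F w)) /= mulr_sumr.
by apply: eq_bigr => w _; rewrite sum_const_natl card_ord.
Qed.

(** Flipping bit [i] exchanges the two halves of [E], which does not depend on that bit. *)
Lemma card_flip (i : 'I_n) b (E : pred (bits n)) :
    (forall A b', E (upd A i b') = E A) ->
  (#|[set A : bits n | E A]| = 2 * #|[set A : bits n | E A && (A i == b)]|)%N.
Proof.
move=> EP; pose h (A : bits n) := upd A i (~~ A i).
have hK : involutive h by move=> A; rewrite /h upd_at negbK updK.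
have -> : [set A | E A] = [set A | E A && (A i == b)] :|: [set A | E A && (A i != b)].
  by apply/setP => A; rewrite !inE; case: (A i == b); rewrite /= ?andbT ?andbF ?orbF.
rewrite cardsU (_ : _ :&: _ = set0) ?cards0 ?subn0; last first.
  by apply/setP => A; rewrite !inE; case: (A i == b); rewrite /= ?andbF.
rewrite mul2n -addnn; congr (_ + _)%N.
rewrite -(card_preimset _ (inv_inj hK)); apply: eq_card => A.
by rewrite !inE EP upd_at; case: (A i); case: b.
Qed.

Variables (V : finType) (L : input k n -> V).

(** Divided by [2 ^ n], this is the law [p_S] of the leaf for uniform [A]. *)
Definition hits i (w : {ffun 'I_n -> 'I_k}) S v : nat :=
  #|[set A : bits n | L (xset i S w A) == v]|.

Lemma sum_hits i w S : (\sum_v hits i w S v = 2 ^ n)%N.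
Proof.
rewrite -[RHS](_ : #|bits n| = _)%N; last by rewrite card_ffun card_bool card_ord.
rewrite -sum1_card (partition_big (fun A => L (xset i S w A)) xpredT) //=.
apply: eq_bigr => v _; rewrite sum1dep_card /hits.
by apply: eq_card => A; rewrite !inE.
Qed.

Lemma hits_updw i (w : {ffun 'I_n -> 'I_k}) j S v :
  hits i (upd w i j) S v = hits i w S v.
Proof. by apply: eq_card => A; rewrite !inE xset_updw. Qed.

(** Conditioning on [A i = true] amounts to planting the column [[set w i]]; the factor 2 is the
    inverse of the probability of this event. *)
Lemma hits_fiber1 i (w : {ffun 'I_n -> 'I_k}) v :
  hits i w [set w i] v = (2 * fiber (fun A => L (xin w A)) v i true)%N.
Proof.
rewrite /hits (@card_flip i true (fun A => L (xset i [set w i] w A) == v)).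
  congr (2 * _)%N; apply: eq_card => A; rewrite !inE.
  by case Ai: (A i); rewrite ?andbF //= xset1E.
by move=> A b; rewrite xset_updA.
Qed.

Lemma hits_fiber0 i (w : {ffun 'I_n -> 'I_k}) v :
  hits i w set0 v = (2 * fiber (fun A => L (xin w A)) v i false)%N.
Proof.
rewrite /hits (@card_flip i false (fun A => L (xset i set0 w A) == v)).
  congr (2 * _)%N; apply: eq_card => A; rewrite !inE.
  by case Ai: (A i); rewrite ?andbF //= xset0E ?Ai.
by move=> A b; rewrite xset_updA.
Qed.

Hypothesis L_mix : forall x y z : input k n,
  L x = L y -> (forall j, z j = x j \/ z j = y j) -> L z = L x.

(* Exchanging the bits owned by the parties in [S] between the two inputs
   is an involution that trades the pair (set0, S :|: S') for (S, S'). *)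
Lemma hits_cut i (w : {ffun 'I_n -> 'I_k}) (S S' : {set 'I_k}) v :
  [disjoint S & S'] ->
  (hits i w set0 v * hits i w (S :|: S') v = hits i w S v * hits i w S' v)%N.
Proof.
move=> dis; rewrite /hits -!cardsX.
pose h (p : bits n * bits n) : bits n * bits n :=
  ([ffun i' => if w i' \in S then p.2 i' else p.1 i'],
   [ffun i' => if w i' \in S then p.1 i' else p.2 i']).
have hK : involutive h.
  case=> A A'; congr pair; apply/ffunP => i'; rewrite !ffunE /= ?ffunE;
  by case: (w i' \in S).
rewrite -[RHS](card_preimset _ (inv_inj hK)); apply: eq_card => -[A A'].
rewrite !inE /=; set B := [ffun i' => _]; set B' := [ffun i' => _].
(* Party by party, the two inputs of one pair are those of the other pair, exchanged or not, so
   [L_mix] carries the value [v] in both directions. *)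
have in1 j : j \in S -> (xset i S w B j = xset i (S :|: S') w A' j) *
    (xset i S' w B' j = xset i set0 w A j).
  move=> jS; have jS' : j \in S' = false by apply: (disjointFr dis).
  split; apply/ffunP => i'; rewrite !ffunE !inE /= ?jS ?jS' //;
  by case: eqP => // _; case: (w i' =P j) => // ->; rewrite jS.
have in0 j : j \notin S -> (xset i S w B j = xset i set0 w A j) *
    (xset i S' w B' j = xset i (S :|: S') w A' j).
  move=> /negbTE jS.
  split; apply/ffunP => i'; rewrite !ffunE !inE /= ?jS //;
  by case: eqP => // _; case: (w i' =P j) => // ->; rewrite jS.
apply/andP/andP => -[/eqP e1 /eqP e2].
  have e : L (xset i set0 w A) = L (xset i (S :|: S') w A') by rewrite e1.
  split; rewrite -e1; apply/eqP; apply: (L_mix e) => j;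
    by case: (boolP (j \in S)) => jS; rewrite ?(in1 j jS) ?(in0 j jS); auto.
have e : L (xset i S w B) = L (xset i S' w B') by rewrite e1.
split; rewrite -e1; apply/eqP; apply: (L_mix e) => j;
  by case: (boolP (j \in S)) => jS; rewrite ?(in1 j jS) ?(in0 j jS); auto.
Qed.

End Coordinate.

(** * The direct sum over the coordinates *)

Section DirectSum.
Variables (R : realType) (k n : nat) (V : finType) (L : input k n -> V).

Definition amp (i : 'I_n) (w : {ffun 'I_n -> 'I_k}) (S : {set 'I_k}) (v : V) : R :=
  Num.sqrt ((hits L i w S v)%:R / 2 ^+ n).

Definition hdist i w S : R := hellinger (amp i w) S.

Lemma hits_frac_ge0 i w S v : 0 <= (hits L i w S v)%:R / 2 ^+ n :> R.
Proof. by rewrite divr_ge0 // exprn_ge0. Qed.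

Lemma pow2_gt0 : 0 < 2 ^+ n :> R. Proof. by rewrite exprn_gt0. Qed.

Lemma sum_hits_frac i w S : \sum_v (hits L i w S v)%:R / 2 ^+ n = 1 :> R.
Proof.
by rewrite -mulr_suml -natr_sum sum_hits natrX divff // gt_eqF // pow2_gt0.
Qed.

Lemma amp_unit i w S : \sum_v amp i w S v ^+ 2 = 1.
Proof.
rewrite -[RHS](sum_hits_frac i w S); apply: eq_bigr => v _.
by rewrite sqr_sqrtr // hits_frac_ge0.
Qed.

Lemma hdist_updw i w j S : hdist i (upd w i j) S = hdist i w S.
Proof.
by congr (1 - _); apply: eq_bigr => v _; rewrite /amp !hits_updw.
Qed.

(** Read [o] as the output at a leaf: a leaf with [o v] is an error under [set0], any other one is
    an error under [setT]. Rare errors therefore leave little overlap between the two laws. *)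
Lemma hdist_full_ge (o : pred V) i w :
  2 ^+ n * (3 / 4) - 2 * (#|[set A | o (L (xset i set0 w A))]|%:R +
                          #|[set A | ~~ o (L (xset i setT w A))]|%:R) <=
  2 ^+ n * hdist i w setT.
Proof.
have count (q : pred V) S : #|[set A | q (L (xset i S w A))]|%:R / 2 ^+ n =
    \sum_(v | q v) (hits L i w S v)%:R / 2 ^+ n :> R.
  rewrite -mulr_suml; congr (_ / _); rewrite -natr_sum; congr (_%:R).
  rewrite -sum1_card (partition_big (fun A => L (xset i S w A)) q) /=; last first.
    by move=> A; rewrite inE.
  apply: eq_bigr => v qv; rewrite sum1dep_card /hits; apply: eq_card => A.
  by rewrite !inE; case: eqP => [->|]; rewrite ?qv ?andbF.
have D0 := pow2_gt0.
rewrite -ler_pdivrMl // mulrBr.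
set t0 := #|_|%:R; set t1 := #|_|%:R.
have -> : (2 ^+ n)^-1 * (2 ^+ n * (3 / 4)) - (2 ^+ n)^-1 * (2 * (t0 + t1)) =
    1 - (1 / 4 + 2 * (t0 / 2 ^+ n) + 2 * (t1 / 2 ^+ n)) :> R.
  by field; rewrite gt_eqF.
rewrite lerD2l lerN2 /t0 /t1 (count o set0) (count (fun v => ~~ o v) setT).
pose a v : R := (hits L i w set0 v)%:R / 2 ^+ n.
pose b v : R := (hits L i w setT v)%:R / 2 ^+ n.
(* AM-GM with the weight 4 on the side where the output is wrong. *)
have le1 v : amp i w set0 v * amp i w setT v <=
    a v / 8 + b v / 8 + 2 * (if o v then a v else 0) +
    2 * (if ~~ o v then b v else 0).
  have ea : amp i w set0 v ^+ 2 = a v by rewrite sqr_sqrtr // hits_frac_ge0.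
  have eb : amp i w setT v ^+ 2 = b v by rewrite sqr_sqrtr // hits_frac_ge0.
  rewrite -ea -eb; move: (amp _ _ _ _) (amp _ _ _ _) => r s.
  have := sqr_ge0 (4 * r - s); have := sqr_ge0 (r - 4 * s).
  have := sqr_ge0 r; have := sqr_ge0 s.
  case: (o v) => /=; nra.
have sa : \sum_v a v = 1 by apply: sum_hits_frac.
have sb : \sum_v b v = 1 by apply: sum_hits_frac.
change (\sum_v amp i w set0 v * amp i w setT v <=
  1 / 4 + 2 * (\sum_(v | o v) a v) + 2 * (\sum_(v | ~~ o v) b v)).
clearbody a b; apply: le_trans (ler_sum _ (fun v _ => le1 v)) _.
rewrite !big_split /= -!mulr_sumr -!mulr_suml -!big_mkcond /= sa sb; lra.
Qed.

Hypothesis L_mix : forall x y z : input k n,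
  L x = L y -> (forall j, z j = x j \/ z j = y j) -> L z = L x.

Lemma amp_cut i w (S S' : {set 'I_k}) : [disjoint S & S'] ->
  forall v, amp i w set0 v * amp i w (S :|: S') v = amp i w S v * amp i w S' v.
Proof.
move=> dis v; rewrite /amp -!sqrtrM ?hits_frac_ge0 //; congr Num.sqrt.
by rewrite mulrACA -natrM hits_cut // natrM mulrACA.
Qed.

Variable P : V -> R.
Hypothesis P_ge0 : forall v, 0 <= P v.
Hypothesis P_sum : \sum_v P v <= 1.
Hypothesis P_gt0 : forall w A, 0 < P (L (xin w A)).

(** One [P] serves every [w], since it will be the law of the leaf averaged over [W]; hence a cross
    entropy rather than the entropy for fixed [w]. *)
Lemma info_fixed w : 2 ^+ n / 2 * \sum_i hdist i w [set w i] <=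
  \sum_A - ln (P (L (xin w A))).
Proof.
apply: le_trans (cross_entropy_ge P_ge0 P_sum (P_gt0 w)).
rewrite mulr_sumr; apply: ler_sum => i _.
have <- : \sum_v 2 ^+ n / 4 * (amp i w set0 v - amp i w [set w i] v) ^+ 2 =
    2 ^+ n / 2 * hdist i w [set w i].
  by rewrite -mulr_sumr (sum_sqrB (amp_unit i w)) /hdist /hellinger; field.
apply: ler_sum => v _; rewrite /amp hits_fiber1 hits_fiber0 !natrM.
have D0 := pow2_gt0.
have d0 : 0 <= 2 / 2 ^+ n :> R by rewrite divr_ge0 // ltW.
rewrite ![2%:R * _ / _]mulrAC !(@sqrtrM _ (2 / 2 ^+ n)) //.
rewrite -mulrBr exprMn sqr_sqrtr //.
rewrite le_eqVlt; apply/orP; left; apply/eqP.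
by field; rewrite gt_eqF.
Qed.

(** The 12 is the 2 of [info_fixed] times the 6 of [hellinger_full_le]; [1 / k] is the probability
    of [W_i = j]. *)
Lemma info_total : (2 <= k)%N ->
  2 ^+ n / (12 * k%:R) * \sum_w \sum_i hdist i w setT <=
  \sum_w \sum_A - ln (P (L (xin w A))).
Proof.
move=> k2; have k0 : 0 < k%:R :> R by rewrite ltr0n ltnW.
apply: le_trans (ler_sum _ (fun w _ => info_fixed w)).
rewrite -mulr_sumr [X in _ <= _ * X]exchange_big /=.
rewrite [X in _ * X <= _]exchange_big /=.
have -> : 2 ^+ n / (12 * k%:R) * \sum_i \sum_w hdist i w setT =
    2 ^+ n / 2 * \sum_i (6 * k%:R)^-1 * \sum_w hdist i w setT.
  by rewrite -mulr_sumr; field; rewrite gt_eqF.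
rewrite ler_wpM2l ?divr_ge0 ?exprn_ge0 //; apply: ler_sum => i _.
(* Resampling [w i] makes [[set w i]] run through all singletons, while the laws do not depend on
   [w i]. *)
rewrite ler_pdivrMl ?mulr_gt0 // -mulrA -(sum_upd i (fun w => hdist i w [set w i])).
rewrite mulr_sumr; apply: ler_sum => w _.
under eq_bigr do rewrite upd_at hdist_updw.
apply: hellinger_full_le; last by rewrite card_ord.
  exact: amp_unit.
exact: amp_cut.
Qed.

End DirectSum.

(** * Mutual information when one variable determines the other *)

Section FiniteInfo.
Variables (R : realType) (T : finType) (p : T -> R).
Hypothesis p_ge0 : forall t, 0 <= p t.

Lemma law_sum (U : finType) (X : T -> U) (F : U -> R) :
  \sum_u law p X u * F u = \sum_t p t * F (X t).
Proof.
rewrite [RHS](partition_big X xpredT) //=; apply: eq_bigr => u _.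
by rewrite /law /prob mulr_suml; apply: eq_bigr => t /eqP ->.
Qed.

Lemma law_ge (U : finType) (X : T -> U) t : p t <= law p X (X t).
Proof.
by rewrite /law /prob (bigD1 t) //= lerDl sumr_ge0.
Qed.

(** The joint law at [(X t, g (X t))] is that of [X] alone, so only the entropy of [g (X t)]
    remains. *)
Lemma mutual_info_function (U V : finType) (X : T -> U) (g : U -> V) :
  mutual_info p X (fun t => g (X t)) =
  \sum_t p t * - log2 (law p (fun t => g (X t)) (g (X t))).
Proof.
rewrite /mutual_info pair_bigA /=; set Y := fun t => g (X t).
under eq_bigr => u _ do rewrite -surjective_pairing.
rewrite (law_sum (fun t => (X t, Y t)) 
  (fun u => log2 (law p (fun t => (X t, Y t)) u / (law p X u.1 * law p Y u.2)))).
apply: eq_bigr => t _; rewrite /=.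
have [->|pt] := eqVneq (p t) 0; first by rewrite !mul0r.
have pt0 : 0 < p t by rewrite lt_def pt p_ge0.
have -> : law p (fun t => (X t, Y t)) (X t, Y t) = law p X (X t).
  apply: eq_bigl => s; rewrite xpair_eqE; case: eqP => //= e.
  by rewrite /Y e eqxx.
have x0 := lt_le_trans pt0 (law_ge X t).
have y0 := lt_le_trans pt0 (law_ge Y t).
have -> : law p X (X t) / (law p X (X t) * law p Y (Y t)) = (law p Y (Y t))^-1.
  by field; rewrite !gt_eqF.
by rewrite /log2 lnV ?posrE // mulNr.
Qed.

End FiniteInfo.

(** * Inputs under the hard distribution *)

Section HardInputs.
Variables (R : realType) (k n : nat).

Lemma sum_outcome (F : outcome k n -> R) :
  \sum_t F t = \sum_w \sum_A \sum_b \sum_l F (w, A, b, l).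
Proof.
by rewrite pair_bigA /= pair_bigA /= pair_bigA /=; apply: eq_bigr => -[[[w A] b] l].
Qed.

Lemma rvx_false w A l : rvx (w, A, false, l) = xin w A :> input k n.
Proof. by apply/ffunP => j; apply/ffunP => i; rewrite !ffunE. Qed.

Lemma rvx_true w A l : rvx (w, A, true, l) = xset l setT w A :> input k n.
Proof.
by apply/ffunP => j; apply/ffunP => i; rewrite !ffunE /= in_setT; case: eqP.
Qed.

Lemma column_le1 (w : {ffun 'I_n -> 'I_k}) (A : bits n) i :
  (\sum_j ((w i == j) && A i : nat) <= 1)%N.
Proof.
apply: (@leq_trans (\sum_j (w i == j))).
  by apply: leq_sum => j _; case: (w i == j); case: (A i).
rewrite (bigD1 (w i)) //= eqxx big1 // => j /negbTE.
by rewrite eq_sym => ->.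
Qed.

Lemma kUDISJ_xin (w : {ffun 'I_n -> 'I_k}) (A : bits n) :
  kUDISJ (xin w A) = Some false.
Proof.
rewrite /kUDISJ ifT // inE; apply/forallP => i.
under eq_bigr do rewrite !ffunE.
exact: column_le1.
Qed.

Lemma kUDISJ_xset l (w : {ffun 'I_n -> 'I_k}) (A : bits n) : (2 <= k)%N ->
  kUDISJ (xset l setT w A) = Some true.
Proof.
move=> k2; rewrite /kUDISJ ifF ?ifT //.
  rewrite inE; apply/existsP; exists l; apply/andP; split.
    by apply/forallP => j; rewrite !ffunE eqxx in_setT.
  apply/forall_inP => i /negbTE il.
  under eq_bigr do rewrite !ffunE il.
  exact: column_le1.
(* Column [l] sums to [k >= 2], which excludes [D0]. *)
apply/negbTE; rewrite inE; apply/forallPn; exists l.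
under eq_bigr do rewrite !ffunE eqxx in_setT.
by rewrite sum1_card card_ord -ltnNge.
Qed.

Lemma card_outcome : #|{: outcome k n}| = (k ^ n * 2 ^ n * 2 * n)%N.
Proof. by rewrite !card_prod !card_ffun card_bool !card_ord. Qed.

Lemma jointQE w A b l : (0 < k)%N -> (0 < n)%N ->
  jointQ R k n (w, A, b, l) = if b then 0 else (k%:R ^+ n * 2 ^+ n * n%:R)^-1.
Proof.
move=> k0 n0; rewrite /jointQ /cond /=; case: b => //=.
have kR : k%:R != 0 :> R by rewrite pnatr_eq0 -lt0n.
have nR : n%:R != 0 :> R by rewrite pnatr_eq0 -lt0n.
have -> : prob (uniform R (outcome k n)) (fun t => ~~ rvB t) = 2^-1.
  rewrite /prob big_mkcond /= sum_outcome /uniform card_outcome.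
  under eq_bigr => w' _ do under eq_bigr => A' _ do
    rewrite big_bool /= big1_eq add0r sum_const_natl.
  under eq_bigr => w' _ do rewrite sum_const_natl.
  rewrite sum_const_natl !card_ffun card_bool !card_ord !natrM !natrX.
  by field; rewrite ?expf_neq0 ?kR ?nR ?pnatr_eq0.
rewrite /uniform card_outcome !natrM !natrX.
by field; rewrite ?expf_neq0 ?kR ?nR ?pnatr_eq0.
Qed.

Lemma prob_distP (E : pred (input k n)) :
  prob (distP R k n) E = (#|{: outcome k n}|%:R)^-1 *
    \sum_w \sum_A \sum_b \sum_l (E (rvx (w, A, b, l)))%:R.
Proof.
have -> : prob (distP R k n) E = \sum_x distP R k n x * (E x)%:R.
  rewrite /prob big_mkcond; apply: eq_bigr => x _.
  by case: (E x); rewrite ?mulr1 ?mulr0.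
by rewrite law_sum -mulr_sumr sum_outcome.
Qed.

End HardInputs.

(** * Counting the errors of the protocol *)

Section Correctness.
Variables (R : realType) (k n : nat) (C : protocol k n) (eps : R).
Hypotheses (k_ge2 : (2 <= k)%N) (n_gt0 : (0 < n)%N).
Hypothesis correct :
  1 - eps <= prob (distP R k n) (fun x => Some (output C x) == kUDISJ x).

Let K : R := k%:R ^+ n.
Let D : R := 2 ^+ n.

(** The right side is [eps] times the number [2 K D n] of outcomes; the left side bounds the number
    of erroneous outcomes from below. *)
Lemma error_count :
  \sum_w \sum_l (#|[set A | output C (xset l set0 w A)]|%:R / 2 +
                 #|[set A | ~~ output C (xset l setT w A)]|%:R) <=
  2 * eps * (K * D * n%:R).
Proof.
have k0 : 0 < k%:R :> R by rewrite ltr0n ltnW.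
have n0 : 0 < n%:R :> R by rewrite ltr0n.
have K0 : 0 < K by rewrite exprn_gt0.
have D0 : 0 < D by rewrite exprn_gt0.
have := correct; rewrite prob_distP card_outcome !natrM !natrX -/K -/D.
rewrite ler_pdivlMl ?mulr_gt0 //.
pose F w l : R := \sum_A ((~~ output C (xset l setT w A))%:R + (output C (xin w A))%:R).
have -> : \sum_w \sum_A \sum_b \sum_l
      (Some (output C (rvx (w, A, b, l))) == kUDISJ (rvx (w, A, b, l)))%:R =
    K * D * 2 * n%:R - \sum_w \sum_l F w l.
  have -> : K * D * 2 * n%:R = \sum_(w : {ffun 'I_n -> 'I_k}) \sum_(l < n) \sum_(A : bits n) 2.
    do 3 under eq_bigr => w _ do rewrite ?sum_const_natl.
    rewrite !sum_const_natl !card_ffun card_bool !card_ord !natrX -/K -/D; ring.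
  rewrite -sumrB; apply: eq_bigr => w _; rewrite -sumrB exchange_big big_bool /=.
  rewrite exchange_big [X in _ + X]exchange_big /= -big_split /=.
  apply: eq_bigr => l _; rewrite -big_split -sumrB; apply: eq_bigr => A _ /=.
  rewrite rvx_true rvx_false kUDISJ_xset // kUDISJ_xin.
  by case: (output C (xin w A)); case: (output C (xset l setT w A)) => /=; ring.
move=> le1.
suff le2 : \sum_w \sum_l (#|[set A | output C (xset l set0 w A)]|%:R / 2 +
       #|[set A | ~~ output C (xset l setT w A)]|%:R) <= \sum_w \sum_l F w l by lra.
apply: ler_sum => w _; apply: ler_sum => l _; rewrite /F big_split /= addrC.
have cnt (q : pred (bits n)) : #|[set A | q A]|%:R = \sum_A (q A)%:R :> R.
  rewrite -natr_sum -sum1_card; congr (_%:R); rewrite big_mkcond /=.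
  by apply: eq_bigr => A _; rewrite inE; case: (q A).
rewrite [X in _ + X <= _]cnt lerD2r.
(* For [B = 0] only errors with [A l = false] are kept, where [xin w A] is [xset l set0 w A]. The
   latter ignores [A l], so they are half of the count over all [A]. *)
rewrite (@card_flip n l false (fun A => output C (xset l set0 w A))); last first.
  by move=> A b; rewrite xset_updA.
rewrite natrM mulrC mulKf ?pnatr_eq0 //.
rewrite (cnt (fun A : bits n => output C (xset l set0 w A) && (A l == false))).
apply: ler_sum => A _; rewrite ler_nat.
case Al: (A l); first by rewrite andbF.
by rewrite andbT xset0E // Al.
Qed.

End Correctness.

(** * The lower bound on the information *)

Theorem theorem4p3 (R : realType) (eps : R) (eps_gt0 : 0 < eps)
    (eps_lt : eps < 10 ^- 4) :
  exists c : R, 0 < c /\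
    forall (k n : nat) (C : protocol k n), (2 <= k)%N -> (1 <= n)%N ->
      1 - eps <= prob (distP R k n) (fun x => Some (output C x) == kUDISJ x) ->
      c * (n%:R / k%:R) <=
        mutual_info (jointQ R k n) (fun t => (rvx t, rvW t))
          (fun t => leaf_rect C (rvx t)).
Proof.
(* The average of [hdist] at [setT] is at least [3/4 - 8 eps >= 1/2], and [info_total] divides it by
   [12 k]. *)
exists (1 / 24); split=> [|k n C k2 n1 correct]; first by rewrite divr_gt0.
have k_gt0 : (0 < k)%N by exact: ltnW.
have k0 : 0 < k%:R :> R by rewrite ltr0n.
have n0 : 0 < n%:R :> R by rewrite ltr0n.
pose K : R := k%:R ^+ n; pose D : R := 2 ^+ n.
have K0 : 0 < K by rewrite exprn_gt0.
have D0 : 0 < D by rewrite exprn_gt0.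
pose L := leaf_rect C; pose q := (K * D * n%:R)^-1.
have q0 : 0 < q by rewrite invr_gt0 !mulr_gt0.
have QE w A b l : jointQ R k n (w, A, b, l) = if b then 0 else q by rewrite jointQE.
have Q_ge0 t : 0 <= jointQ R k n t.
  by case: t => [[[w A] b] l]; rewrite QE; case: b; rewrite // ltW.
rewrite (mutual_info_function Q_ge0 (fun t => (rvx t, rvW t)) (fun u => L u.1)) /=.
(* What remains is the entropy of the leaf, whose law given [B = 0] is [P]. *)
set P := law _ _; pose l0 : 'I_n := Ordinal n1.
have sumQ (F : outcome k n -> R) : \sum_t jointQ R k n t * F t =
    q * \sum_w \sum_A \sum_l F (w, A, false, l).
  rewrite sum_outcome mulr_sumr; apply: eq_bigr => w _.
  rewrite mulr_sumr; apply: eq_bigr => A _.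
  rewrite big_bool /= big1 ?add0r; last by move=> l _; rewrite QE mul0r.
  by rewrite mulr_sumr; apply: eq_bigr => l _; rewrite QE.
have P_ge0 v : 0 <= P v by rewrite /P /law /prob sumr_ge0.
have P_sum : \sum_v P v <= 1.
  under eq_bigr do rewrite -[P _]mulr1.
  rewrite (law_sum _ _ (fun=> 1)) sumQ.
  under eq_bigr => w _ do under eq_bigr => A _ do rewrite sum_const_natl.
  under eq_bigr => w _ do rewrite sum_const_natl.
  rewrite sum_const_natl !card_ffun card_bool !card_ord !natrX -/K -/D /q.
  by rewrite mulr1 mulrA mulVf // gt_eqF // !mulr_gt0.
have P_gt0 w A : 0 < P (L (xin w A)).
  have := law_ge Q_ge0 (fun t => L (rvx t)) (w, A, false, l0).
  by rewrite QE /= rvx_false; apply: lt_le_trans.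
have Lmix : forall x y z : input k n,
    L x = L y -> (forall j, z j = x j \/ z j = y j) -> L z = L x.
  by move=> x y z; apply: leaf_rect_mix.
have info := info_total Lmix P_ge0 P_sum P_gt0 k2; rewrite -/D in info.
(* The output as a function of the leaf rectangle, false on sets that are not leaves. *)
pose o (v : {set input k n}) := [exists x, (L x == v) && output C x].
have oL x : o (L x) = output C x.
  apply/existsP/idP => [[y /andP [/eqP e oy]]|ox]; last by exists x; rewrite eqxx.
  by rewrite -(leaf_output (leaf_rect_eq e)).
have err := error_count k2 n1 correct; rewrite -/K -/D in err.
have far : K * D * n%:R / 2 <= \sum_w \sum_i D * hdist R L i w setT.
  (* The weight 4 on [t0 / 2 + t1], as in [error_count], dominates the [2 (t0 + t1)] of
     [hdist_full_ge]. *)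
  apply: (@le_trans _ _ (\sum_(w : {ffun 'I_n -> 'I_k}) \sum_(l < n) (D * (3 / 4) - 4 *
      (#|[set A | output C (xset l set0 w A)]|%:R / 2 +
       #|[set A | ~~ output C (xset l setT w A)]|%:R)))); last first.
    apply: ler_sum => w _; apply: ler_sum => i _.
    apply: le_trans (hdist_full_ge R L o i w); rewrite -/D lerD2l lerN2.
    have -> : [set A | o (L (xset i set0 w A))] =
        [set A | output C (xset i set0 w A)] by apply/setP => A; rewrite !inE oL.
    have -> : [set A | ~~ o (L (xset i setT w A))] =
        [set A | ~~ output C (xset i setT w A)] by apply/setP => A; rewrite !inE oL.
    have : 0 <= #|[set A | ~~ output C (xset i setT w A)]|%:R :> R by [].
    lra.
  rewrite (eq_bigr (fun w => n%:R * (D * (3 / 4)) - 4 * \sum_(l < n)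
      (#|[set A | output C (xset l set0 w A)]|%:R / 2 +
       #|[set A | ~~ output C (xset l setT w A)]|%:R))); last first.
    by move=> w _; rewrite sumrB sum_const_natl card_ord -mulr_sumr.
  rewrite sumrB sum_const_natl card_ffun !card_ord natrX -/K.
  rewrite -[X in _ - X]mulr_sumr.
  have e1 : eps * (K * D * n%:R) <= 10 ^- 4 * (K * D * n%:R).
    by rewrite ler_wpM2r ?(ltW eps_lt) // ltW // !mulr_gt0.
  have : 0 < K * D * n%:R by rewrite !mulr_gt0.
  move: err e1; set err := \sum_w _ => err_le e1 Z0.
  have -> : K * (n%:R * (D * (3 / 4))) = 3 / 4 * (K * D * n%:R) by ring.
  move: (K * D * n%:R) Z0 err_le e1 => Z Z0 err_le e1.
  lra.
have ln2 : 0 < ln (2 : R) by rewrite ln_gt0 // ltr1n.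
have ln2_le : ln (2 : R) <= 1 by have := @ln_leB1 R 2; lra.
rewrite sumQ /log2.
(* For [B = 0] the input does not depend on [l]; the resulting factor [n] cancels the one in [q]. *)
have -> : \sum_w \sum_A \sum_(l < n) - (ln (P (L (rvx (w, A, false, l)))) / ln 2) =
    n%:R / ln 2 * \sum_w \sum_A - ln (P (L (xin w A))).
  rewrite mulr_sumr; apply: eq_bigr => w _; rewrite mulr_sumr; apply: eq_bigr => A _.
  under eq_bigr => l _ do rewrite rvx_false.
  by rewrite sum_const_natl card_ord; field; rewrite gt_eqF.
set I := \sum_w \sum_A - ln (P (L (xin w A))) in info *.
have le1 : n%:R * K * D / (24 * k%:R) <= I.
  apply: le_trans info.
  have -> : D / (12 * k%:R) * \sum_w \sum_i hdist R L i w setT =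
      (12 * k%:R)^-1 * \sum_w \sum_i D * hdist R L i w setT.
    under [in RHS]eq_bigr => w _ do rewrite -mulr_sumr.
    by rewrite -mulr_sumr; ring.
  have -> : n%:R * K * D / (24 * k%:R) = (12 * k%:R)^-1 * (K * D * n%:R / 2).
    by field; rewrite gt_eqF.
  by rewrite ler_wpM2l // invr_ge0 mulr_ge0 // ltW.
have I0 : 0 <= I by apply: le_trans le1; rewrite divr_ge0 // ?mulr_ge0 // ltW.
have -> : q * (n%:R / ln 2 * I) = I / (K * D) / ln 2.
  by rewrite /q; field; rewrite !gt_eqF.
rewrite ler_pdivlMr //.
(* Passing from nats to bits divides by [ln 2 <= 1], which only helps. *)
apply: (@le_trans _ _ (1 / 24 * (n%:R / k%:R))).
  by rewrite -[leRHS]mulr1 ler_wpM2l // mulr_ge0 // divr_ge0 // ltW.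
rewrite ler_pdivlMr ?mulr_gt0 //; apply: le_trans le1.
by rewrite le_eqVlt; apply/orP; left; apply/eqP; field; rewrite gt_eqF.
Qed.
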